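(* Let $K$ be a convex body in $\mathbb{R}^d$ (a compact convex set with nonempty interior). If the complement $K^c=\mathbb{R}^d\setminus K$ admits a weak tiling by translates of $K$, i.e. there is a positive, locally finite Borel measure $\mu$ on $\mathbb{R}^d$ with $\mathbf{1}_K\ast\mu=\mathbf{1}_{K^c}$ almost everywhere, then $K$ is a convex polytope.
   Context: A measure is locally finite if it gives finite mass to every ball. A convex polytope is the convex hull of finitely many points. *)

(* Defs.v *)
From HB Require Import structures.
From mathcomp Require Import all_boot all_order all_algebra.
From mathcomp Require Import all_classical all_reals all_analysis.
Set Implicit Arguments. Unset Strict Implicit. Unset Printing Implicit Defensive.
Import Order.TTheory GRing.Theory Num.Theory.
Import numFieldNormedType.Exports.
Local Open Scope classical_set_scope.
Local Open Scope ring_scope.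

Definition open_sets_Rd (R : realType) (d : nat) : set (set 'rV[R]_d) :=
  [set A | open A].

Definition BorelRd (R : realType) (d : nat) := g_sigma_algebraType (@open_sets_Rd R d).

Definition convex_body (R : realType) (d : nat) (K : set 'rV[R]_d) : Prop :=
  [/\ compact K, @convex_set R 'rV[R]_d K & interior K !=set0].

Definition conv_hull (R : realType) (d : nat) (S : set 'rV[R]_d) : set 'rV[R]_d :=
  \bigcap_(C in [set C : set 'rV[R]_d | @convex_set R 'rV[R]_d C /\ S `<=` C]) C.

Definition convex_polytope (R : realType) (d : nat) (K : set 'rV[R]_d) : Prop :=
  exists s : seq 'rV[R]_d, K = conv_hull [set` s].

Definition box (R : realType) (d : nat) (a b : 'rV[R]_d) : set 'rV[R]_d :=
  [set x | forall i : 'I_d, a ord0 i <= x ord0 i <= b ord0 i].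
Definition box_vol (R : realType) (d : nat) (a b : 'rV[R]_d) : R :=
  \prod_(i < d) (b ord0 i - a ord0 i).

Definition lebesgue_null (R : realType) (d : nat) (N : set 'rV[R]_d) : Prop :=
  forall eps : R, 0 < eps ->
  exists a b : nat -> 'rV[R]_d,
    [/\ (forall n (i : 'I_d), a n ord0 i <= b n ord0 i),
        N `<=` \bigcup_n box (a n) (b n) &
        (\sum_(0 <= n <oo) (box_vol (a n) (b n))%:E < eps%:E)%E].

Definition locally_finite (R : realType) (d : nat)
    (mu : {measure set (BorelRd R d) -> \bar R}) : Prop :=
  forall (x : 'rV[R]_d) (r : R), (mu (ball x r) < +oo)%E.

(* Main.v *)
Require Import Defs.
From HB Require Import structures.
From mathcomp Require Import all_boot all_order all_algebra.
From mathcomp Require Import all_classical all_reals all_analysis.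
From mathcomp Require Import measurable_realfun ring lra.
Set Implicit Arguments. Unset Strict Implicit. Unset Printing Implicit Defensive.
Import Order.TTheory GRing.Theory Num.Theory.
Import numFieldNormedType.Exports.
Local Open Scope classical_set_scope.
Local Open Scope ring_scope.

(* The translates [K + t] that meet the interior of [K] form a [mu]-null set,
   while at every boundary point [x] the translates containing [x] have mass at
   least 1, because points outside [K] arbitrarily close to [x] are covered with
   total weight 1.  If [K] contains a Euclidean ball touching the boundary at
   [x], there is a single supporting halfspace at [x], and a translate through
   [x] not overlapping [K] lies on its other side.  Hence touching points with
   distinct halfspaces are covered by disjoint sets of translates, each of mass
   at least 1, inside a fixed ball; by local finiteness there are finitely many
   such halfspaces.  Their intersection is [K]. *)

(** * Euclidean inner product *)

Definition dot {R : realType} {d : nat} (u v : 'rV[R]_d) : R :=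
  \sum_i u ord0 i * v ord0 i.

Section Dot.
Context {R : realType} {d : nat}.
Implicit Types u v w : 'rV[R]_d.

Lemma dotC u v : dot u v = dot v u.
Proof. by apply: eq_bigr => i _; rewrite mulrC. Qed.

Lemma dotDl u v w : dot (u + v) w = dot u w + dot v w.
Proof. by rewrite -big_split; apply: eq_bigr => i _; rewrite mxE mulrDl. Qed.

Lemma dotZl k u v : dot (k *: u) v = k * dot u v.
Proof. by rewrite mulr_sumr; apply: eq_bigr => i _; rewrite mxE mulrA. Qed.

Lemma dotNl u v : dot (- u) v = - dot u v.
Proof. by rewrite -scaleN1r dotZl mulN1r. Qed.

Lemma dotDr u v w : dot w (u + v) = dot w u + dot w v.
Proof. by rewrite dotC dotDl !(dotC w). Qed.

Lemma dotZr k u v : dot u (k *: v) = k * dot u v.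
Proof. by rewrite dotC dotZl dotC. Qed.

Lemma dotNr u v : dot u (- v) = - dot u v.
Proof. by rewrite dotC dotNl dotC. Qed.

Definition dotE := (dotDl, dotDr, dotNl, dotNr, dotZl, dotZr).

Lemma sqr_coord_le_dot u i : (u ord0 i) ^+ 2 <= dot u u.
Proof.
rewrite /dot (bigD1 i) //= expr2 lerDl sumr_ge0 // => j _.
by rewrite -expr2 sqr_ge0.
Qed.

Lemma dot_ge0 u : 0 <= dot u u.
Proof. by apply: sumr_ge0 => i _; rewrite -expr2 sqr_ge0. Qed.

Lemma dot_gt0 u : u != 0 -> 0 < dot u u.
Proof.
apply: contra_neqT; rewrite -leNgt => u0; apply/rowP => i; rewrite mxE.
apply/eqP; rewrite -sqrf_eq0 eq_le sqr_ge0 andbT.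
exact: le_trans (sqr_coord_le_dot u i) u0.
Qed.

Lemma dot_dist_continuous w : continuous (fun z : 'rV[R]_d => dot (z - w) (z - w)).
Proof.
apply: continuous_big => [|i _]; first exact: add_continuous.
have h : continuous (fun y : 'rV[R]_d => (y - w) ord0 i).
  under eq_fun do rewrite !mxE.
  move=> z; apply: continuousB; last exact: cst_continuous.
  exact: coord_continuous.
by move=> z; apply: continuousM; exact: h.
Qed.

(** The norm on row vectors is the sup norm. This trades its balls for Euclidean ones, whose
    smoothness gives a single supporting halfspace at a touching point. *)
Lemma interior_dotP (K : set 'rV[R]_d) p :
  interior K p <-> exists2 r, 0 < r & forall w, dot (w - p) (w - p) < r ^+ 2 -> K w.
Proof.
split=> [/nbhs_ballP[r /= r0 rK]|[r r0 rK]].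
  exists r => // w wp; apply: rK; split=> // i j; rewrite (ord1 i).
  rewrite -ball_normE /= -ltr_sqr ?nnegrE ?(ltW r0) // real_normK ?num_real //.
  apply: le_lt_trans wp; apply: le_trans (sqr_coord_le_dot _ j).
  by rewrite !mxE -sqrrN opprB.
have r2 : nbhs (dot (p - p) (p - p)) [set s : R | s < r ^+ 2].
  apply: open_nbhs_nbhs; split; first exact: open_lt.
  by rewrite subrr /= -(scale0r 0) dotZl mul0r exprn_gt0.
have : \forall w \near p, dot (w - p) (w - p) < r ^+ 2 := dot_dist_continuous r2.
by apply: filterS => w; exact: rK.
Qed.

End Dot.

(** * Touching points and supporting halfspaces *)

Section ConvexBody.
Context {R : realType} {d : nat} (K : set 'rV[R]_d).
Hypotheses (cK : @convex_set R 'rV[R]_d K) (clK : closed K).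
Implicit Types x y z w n p q t : 'rV[R]_d.

Lemma convex_segment x y (s : R) : K x -> K y -> 0 <= s <= 1 -> K (x + s *: (y - x)).
Proof.
move=> Kx Ky s01; have := @cK y x (Itv01 (andP s01).1 (andP s01).2).
rewrite !inE => /(_ Ky Kx); congr K; rewrite /conv /= /unstable.onem.
by apply/rowP => i; rewrite !mxE; ring.
Qed.

(** The homothety of centre [x] and ratio [s] maps a ball around [p] inside [K] to a ball inside
    [K]. *)
Lemma convex_interior_segment x p (s : R) :
  K x -> interior K p -> 0 < s <= 1 -> interior K (x + s *: (p - x)).
Proof.
move=> Kx /interior_dotP[r r0 rK] /andP[s0 s1]; apply/interior_dotP.
exists (s * r); first exact: mulr_gt0.
move=> w wp; rewrite -(_ : x + s *: (x + s^-1 *: (w - x) - x) = w); last first.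
  by apply/rowP => i; rewrite !mxE; field; rewrite gt_eqF.
apply: convex_segment => //; last by rewrite (ltW s0).
apply: rK; have -> : x + s^-1 *: (w - x) - p = s^-1 *: (w - (x + s *: (p - x))).
  by apply/rowP => i; rewrite !mxE; field; rewrite gt_eqF.
rewrite dotZl dotZr mulrA -invfM -expr2 ltr_pdivrMl ?exprn_gt0 //.
by rewrite -exprMn.
Qed.

Lemma closed_ray_limit x w (s0 : R) : 0 < s0 ->
  (forall s, 0 < s < s0 -> K (x + s *: w)) -> K x.
Proof.
move=> s00 h; apply: (@closed_cvg _ _ (0^'+) _ (fun s : R => x + s *: w) K) => //.
  near=> s; apply: h; apply/andP; split; first by near: s; exact: nbhs_right_gt.
  by near: s; exact: nbhs_right_lt.
rewrite -[X in _ --> X]addr0 -(scale0r w).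
by apply: cvgD; [exact: cvg_cst|apply: cvgZr_tmp; exact: cvg_at_right_filter].
Unshelve. all: by end_near. Qed.

(* The Euclidean ball inside [K] touching the boundary at [x] makes [x] a
   smooth boundary point, with outer normal [n]. *)
Definition touching x n :=
  [/\ n != 0, ~ interior K x &
      forall w, dot (w - (x - n)) (w - (x - n)) < dot n n -> interior K w].

(** Expanding the square of [n + s *: w], the ray is inside the ball once
    [s * dot w w < - 2 * dot w n]; adding 1 to [dot w w] keeps the denominator positive. *)
Lemma touching_inner_ray x n w : touching x n -> dot w n < 0 ->
  exists2 s0 : R, 0 < s0 & forall s, 0 < s < s0 -> interior K (x + s *: w).
Proof.
move=> [_ _ h] wn; have w0 : 0 < dot w w + 1 by rewrite ltr_wpDl ?dot_ge0.
exists (- (2 * dot w n) / (dot w w + 1)); first by rewrite divr_gt0 //; lra.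
move=> s /andP[s0]; rewrite ltr_pdivlMr // => sw; apply: h.
have -> : x + s *: w - (x - n) = n + s *: w.
  by apply/rowP => i; rewrite !mxE; ring.
rewrite !dotE (dotC n w); have := mulr_gt0 s0 s0.
by have := dot_ge0 w; nra.
Qed.

Lemma touching_mem x n : touching x n -> K x.
Proof.
move=> xn; have n0 : 0 < dot n n by case: xn => n0 _ _; exact: dot_gt0.
have [|s0 s00 h] := @touching_inner_ray x n (- n) xn; first by rewrite dotNl; lra.
by apply: (@closed_ray_limit x (- n) s0) => // s /h /interior_subset.
Qed.

(** Were [z] strictly beyond the hyperplane, the ray from [x] away from [z] would enter the
    interior, putting [x] between [z] and an interior point. *)
Lemma touching_support x n z : touching x n -> K z -> dot (z - x) n <= 0.
Proof.
move=> xn Kz; rewrite leNgt; apply/negP => zxn.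
have [|s0 s00 h] := @touching_inner_ray x n (x - z) xn.
  by rewrite -opprB dotNl; lra.
have [_ + _] := xn; apply.
have -> : x = z + (1 + s0 / 2)^-1 *: (x + (s0 / 2) *: (x - z) - z).
  by apply/rowP => i; rewrite !mxE; field; lra.
apply: convex_interior_segment => //; first by apply: h; lra.
by rewrite invr_gt0 invf_le1; lra.
Qed.

(** The translations [t] for which the interiors of [K] and [K + t] meet. *)
Definition overlap t := exists a b, [/\ interior K a, interior K b & t = a - b].

(** Were [z] strictly on the inner side, so would be an interior point of [K + t] near it; a short
    segment from [x] towards that point lies in both interiors. *)
Lemma touching_separates x n z t : touching x n ->
  interior K !=set0 -> ~ overlap t -> K (x - t) -> K (z - t) -> 0 <= dot (z - x) n.
Proof.
move=> xn [p Kp] nU Kxt Kzt; rewrite leNgt; apply/negP => zxn; apply: nU.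
pose c := dot (p - (z - t)) n.
(* So small that [s * c] cannot outweigh the negative [dot (z - x) n]. *)
pose s := - dot (z - x) n / (- dot (z - x) n + `|c| + 1).
have den : 0 < - dot (z - x) n + `|c| + 1 by have := normr_ge0 c; lra.
have s01 : 0 < s <= 1.
  by rewrite divr_gt0 ?ler_pdivrMr; have := normr_ge0 c; lra.
pose z' := z - t + s *: (p - (z - t)).
have Kz' : interior K z' by exact: convex_interior_segment.
have z'n : dot (z' - (x - t)) n < 0.
  have -> : z' - (x - t) = z - x + s *: (p - (z - t)).
    by apply/rowP => i; rewrite !mxE; ring.
  rewrite dotDl dotZl -/c; have sE : s * (- dot (z - x) n + `|c| + 1) = - dot (z - x) n.
    by rewrite mulfVK // gt_eqF.
  by have := ler_norm c; have /andP[s0 _] := s01; nra.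
have [s0 s00 h] := touching_inner_ray xn z'n.
pose r := Num.min (s0 / 2) 1.
have r01 : 0 < r <= 1 by rewrite lt_min ge_min; lra.
have rs0 : r < s0 by rewrite gt_min; apply/orP; left; lra.
exists (x + r *: (z' - (x - t))), (x - t + r *: (z' - (x - t))); split.
- by apply: h; rewrite rs0; case/andP: r01 => ->.
- exact: convex_interior_segment.
- by apply/rowP => i; rewrite !mxE; ring.
Qed.

(** The point [x'] lies on the hyperplane at [x], so an inward direction at [x'] that leaves the
    halfspace at [x] would lead to points of [K] outside it. Used contrapositively, to show that no
    non-overlapping translate contains both points. *)
Lemma touching_halfspace_sub x n x' n' t z : touching x n -> touching x' n' ->
  interior K !=set0 -> ~ overlap t -> K (x - t) -> K (x' - t) ->
  dot (z - x') n' <= 0 -> dot (z - x) n <= 0.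
Proof.
move=> xn xn' K0 nU Kx Kx' zn'.
have x'x : dot (x' - x) n = 0.
  apply/eqP; rewrite eq_le (touching_separates xn K0 nU Kx Kx').
  by rewrite (touching_support xn (touching_mem xn')).
have -> : z - x = z - x' + (x' - x) by rewrite addrA subrK.
rewrite dotDl x'x addr0 leNgt; apply/negP => zn.
(* Tilting by [e *: n'] makes the direction strictly inward at [x'] and costs at most half of its
   product with [n]. *)
pose e := dot (z - x') n / (1 + `|dot n' n|) / 2.
have den : 0 < 1 + `|dot n' n| by rewrite ltr_pwDl.
have e0 : 0 < e by rewrite !divr_gt0.
have n'0 : 0 < dot n' n' by apply: dot_gt0; case: xn'.
have wn' : dot (z - x' - e *: n') n' < 0.
  by rewrite dotDl dotNl dotZl; have := mulr_gt0 e0 n'0; lra.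
have wn : 0 < dot (z - x' - e *: n') n.
  have eE : e * (1 + `|dot n' n|) = dot (z - x') n / 2.
    by rewrite /e; field; rewrite gt_eqF.
  by rewrite dotDl dotNl dotZl; have := ler_norm (dot n' n); nra.
have [s0 s00 h] := touching_inner_ray xn' wn'.
have /interior_subset/(touching_support xn) : interior K (x' + (s0 / 2) *: (z - x' - e *: n')).
  by apply: h; lra.
have -> : x' + (s0 / 2) *: (z - x' - e *: n') - x =
  x' - x + (s0 / 2) *: (z - x' - e *: n') by rewrite addrAC.
by rewrite dotDl dotZl x'x; nra.
Qed.

(** Take for [x] a point nearest to [c] outside the interior. *)
Lemma nearest_touching c (rho : R) : interior K c -> 0 < rho ->
  ~ (forall w, dot (w - c) (w - c) < rho ^+ 2 -> interior K w) ->
  exists x n, [/\ touching x n, c = x - n & dot n n < rho ^+ 2].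
Proof.
move=> Kc rho0 /existsNP[q /not_implyP[qc nKq]].
(* The box contains the Euclidean ball of radius [rho], so a minimum over the compact [A] is one
   over the whole complement of the interior. *)
pose A := [set w : 'rV[R]_d | forall i, (`[c ord0 i - rho, c ord0 i + rho]%classic) (w ord0 i)]
          `&` ~` interior K.
have box_dot w : dot (w - c) (w - c) < rho ^+ 2 ->
    forall i, (`[c ord0 i - rho, c ord0 i + rho]%classic) (w ord0 i).
  move=> wc i; have := le_lt_trans (sqr_coord_le_dot (w - c) i) wc.
  rewrite !mxE => h; rewrite /= in_itv /=.
  by rewrite -ler_distl ltW // -ltr_sqr ?nnegrE ?(ltW rho0) // real_normK ?num_real.
have cA : compact A.
  apply: compact_closedI; last exact/open_closedC/open_interior.
  by apply: (rV_compact (A := fun i => _)) => i; exact: segment_compact.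
have [|||x] := @compact_EVT_min _ R (fun w => dot (w - c) (w - c)) A.
- by exists q; split=> //; exact: box_dot.
- exact: cA.
- exact/continuous_subspaceT/dot_dist_continuous.
rewrite inE => -[xbox nKx] xmin.
have xq : dot (x - c) (x - c) < rho ^+ 2.
  by apply: le_lt_trans (qc); apply: xmin; rewrite inE; split=> //; exact: (box_dot _ qc).
exists x, (x - c); rewrite subKr; split=> //; split=> //.
- by apply/eqP => xc; apply: nKx; rewrite -(subrK c x) xc add0r.
rewrite subKr => w wc; apply: contrapT => nKw.
have : dot (x - c) (x - c) <= dot (w - c) (w - c).
  apply: xmin; rewrite inE; split=> //; apply: box_dot; exact: lt_trans xq.
by rewrite leNgt wc.
Qed.

(* Along the segment from an interior point [p] to [y], the distance from
   [p + s (y - p)] to the complement of [K] is at least [(1 - s) r], so the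
   segment cannot leave the interior before reaching [y]. *)
Lemma mem_of_touching_halfspaces y : interior K !=set0 ->
  (forall x n, touching x n -> dot (y - x) n <= 0) -> K y.
Proof.
move=> [p Kp] hy; have /interior_dotP[r r0 rK] := Kp.
have far (s : R) w : 0 <= s < 1 -> interior K (p + s *: (y - p)) ->
    dot (w - (p + s *: (y - p))) (w - (p + s *: (y - p))) < ((1 - s) * r / 2) ^+ 2 ->
    interior K w.
  set c := p + _ => /andP[s0 s1] Kc wc; apply: contrapT => nKw.
  have rho0 : 0 < (1 - s) * r / 2 by rewrite divr_gt0 // mulr_gt0 // subr_gt0.
  have [|x [n [xn cE nn]]] := nearest_touching Kc rho0.
    by move=> h; apply: nKw; exact: h.
  have n0 : 0 < dot n n by case: xn => n0 _ _; exact: dot_gt0.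
  (* As [n] is shorter than [(1 - s) * r / 2], this point is within [r] of [p]. Support at [x], with
     [hy], then bounds [dot (c - x) n] by [- 2 * dot n n], yet it equals [- dot n n]. *)
  have pn : K (p + (2 / (1 - s)) *: n).
    apply: rK; rewrite addrC addKr dotZl dotZr mulrA -expr2.
    have -> : r ^+ 2 = (2 / (1 - s)) ^+ 2 * ((1 - s) * r / 2) ^+ 2.
      by field; rewrite subr_eq0 gt_eqF.
    by rewrite ltr_pM2l // exprn_gt0 // divr_gt0 // subr_gt0.
  have := touching_support xn pn.
  have -> : p + (2 / (1 - s)) *: n - x = p - x + (2 / (1 - s)) *: n.
    by rewrite addrAC.
  rewrite dotDl dotZl => px.
  have : dot (c - x) n = (1 - s) * dot (p - x) n + s * dot (y - x) n.
    rewrite -!dotZl -dotDl; congr dot.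
    by apply/rowP => i; rewrite !mxE; ring.
  have -> : c - x = - n by rewrite cE addrC addKr.
  have := hy x n xn; rewrite dotNl => yx E.
  have : (1 - s) * (dot (p - x) n + 2 / (1 - s) * dot n n) <= 0.
    by rewrite pmulr_rle0 // subr_gt0.
  rewrite mulrDr mulrA mulrCA mulfV ?mulr1; last by rewrite subr_eq0 gt_eqF.
  by nra.
have seg (s : R) : 0 <= s < 1 -> interior K (p + s *: (y - p)).
  move=> /andP[s0 s1]; set D := dot (y - p) (y - p).
  have D0 : 0 <= D by exact: dot_ge0.
  (* A step, in units of [y - p], that is safe at every parameter up to [s]; dividing by [1 + D]
     avoids a square root. *)
  pose eta := (1 - s) * r / 2 / (1 + D).
  have eta0 : 0 < eta by rewrite !divr_gt0 ?mulr_gt0 ?subr_gt0 // ltr_pwDl.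
  have etaE : (1 - s) * r / 2 = eta * (1 + D) by rewrite /eta; field; lra.
  clearbody eta; have etaD : eta ^+ 2 * D < ((1 - s) * r / 2) ^+ 2.
    by rewrite etaE exprMn ltr_pM2l ?exprn_gt0 //; nra.
  pose N := (Num.truncn (s / eta)).+1.
  have N0 : 0 < N%:R :> R by rewrite ltr0n.
  have hN : s / N%:R < eta.
    by rewrite ltr_pdivrMr // mulrC -ltr_pdivrMr // truncnS_gt.
  have h0 : 0 <= s / N%:R by rewrite divr_ge0 // ltW.
  suff /(_ N (leqnn _)) : forall k, (k <= N)%N ->
      interior K (p + (k%:R * (s / N%:R)) *: (y - p)).
    by rewrite mulrCA mulfV ?mulr1 // gt_eqF.
  elim=> [|k IH] kN; first by rewrite mul0r scale0r addr0.
  have ks : k%:R * (s / N%:R) <= s.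
    by rewrite mulrCA ler_piMr // ler_pdivrMr // mul1r ler_nat ltnW.
  apply: far (IH (ltnW kN)) _; first by rewrite mulr_ge0 // (le_lt_trans ks).
  have -> : p + (k.+1%:R * (s / N%:R)) *: (y - p) - (p + (k%:R * (s / N%:R)) *: (y - p))
    = (s / N%:R) *: (y - p).
    by rewrite -natr1; apply/rowP => i; rewrite !mxE; ring.
  rewrite dotZl dotZr mulrA -expr2 -/D.
  apply: (@le_lt_trans _ _ (eta ^+ 2 * D)).
    by rewrite ler_wpM2r // ler_sqr ?nnegrE ?(ltW hN) // ltW.
  apply: lt_le_trans etaD _; rewrite ler_sqr ?nnegrE; last 2 first.
  - by rewrite divr_ge0 // mulr_ge0 // ?ltW // subr_gt0.
  - by rewrite divr_ge0 // mulr_ge0 // ?(ltW r0) // subr_ge0; lra.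
  by rewrite ler_pM2r ?invr_gt0 // ler_pM2r // lerD2l lerN2.
apply: (@closed_ray_limit _ (p - y) 1) => // s /andP[s0 s1].
have -> : y + s *: (p - y) = p + (1 - s) *: (y - p).
  by apply/rowP => i; rewrite !mxE; ring.
by apply: interior_subset; apply: (seg (1 - s)); rewrite subr_ge0 (ltW s1) gtrBl.
Qed.

End ConvexBody.

(** * Bounded polyhedra are polytopes *)

Section Polyhedron.
Context {R : realType} {d : nat} {I : finType} (a : I -> 'rV[R]_d) (b : I -> R).
Implicit Types z v : 'rV[R]_d.

Definition polyhedron : set 'rV[R]_d := [set z | forall i, dot z (a i) <= b i].

Definition tight z : {set I} := [set i | dot z (a i) == b i].

(** The second clause says that the normals of the tight constraints span the space. *)
Definition vertex z := polyhedron z /\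
  forall v, (forall i, i \in tight z -> dot v (a i) = 0) -> v = 0.

Lemma vertex_tight_inj z z' : vertex z -> vertex z' -> tight z = tight z' -> z = z'.
Proof.
move=> [_ zv] _ e; apply/eqP; rewrite -subr_eq0; apply/eqP/zv => i iz.
have := iz; rewrite e dotDl dotNl !inE => /eqP->.
by move: iz; rewrite inE => /eqP->; rewrite subrr.
Qed.

Lemma finite_vertices : finite_set vertex.
Proof.
(* A vertex is recovered from its tight set; [xget] returns the default 0 when no vertex has tight
   set [A]. *)
apply: (@sub_finite_set _ _
  [set xget 0 [set z | vertex z /\ tight z = A] | A in [set: {set I}]]).
  move=> z zv /=; exists (tight z) => //.
  have [] := @xgetPex _ 0 [set z' | vertex z' /\ tight z' = tight z].
    by exists z.
  by move=> zv' e; exact: vertex_tight_inj.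
exact/finite_image/finite_finset.
Qed.

(** The ratio test of the simplex method: follow [v] until the first constraint blocks. Tight
    constraints stay tight, their normals being orthogonal to [v]. *)
Lemma tight_exit z v : polyhedron z ->
  (forall i, i \in tight z -> dot v (a i) = 0) ->
  (exists s : R, 0 <= s /\ ~ polyhedron (z + s *: v)) ->
  exists s : R, [/\ 0 < s, polyhedron (z + s *: v) & tight z \proper tight (z + s *: v)].
Proof.
move=> Pz vz [s [s0 /existsNP[i0 /negP]]]; rewrite -ltNge dotDl dotZl => i0s.
have i0P : 0 < dot v (a i0).
  by rewrite ltNge; apply/negP => v0; have := Pz i0; nra.
pose F i := (b i - dot z (a i)) / dot v (a i).
case: (@arg_minP _ _ _ i0 (fun i => 0 < dot v (a i)) F i0P) => i iP imin.
have slack j : 0 < dot v (a j) -> 0 < b j - dot z (a j).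
  move=> jP; rewrite subr_gt0 lt_neqAle Pz andbT; apply/negP => /eqP jt.
  by move: jP; rewrite vz ?ltxx // inE jt.
have Fi0 : 0 < F i by rewrite divr_gt0 // slack.
exists (F i); split=> //.
- move=> j; rewrite dotDl dotZl; have [jP|jN] := ltP 0 (dot v (a j)).
    by rewrite -lerBrDl -ler_pdivlMr //; exact: imin.
  by have := Pz j; nra.
- apply/properP; split; last first.
    have iN0 : dot v (a i) != 0 by rewrite gt_eqF.
    exists i; first by rewrite inE dotDl dotZl divfK // subrKC.
    by rewrite inE; have := slack i iP; rewrite subr_gt0; move/lt_eqF->.
  apply/fintype.subsetP => j jz; rewrite inE dotDl dotZl vz // mulr0 addr0.
  by rewrite inE in jz.
Qed.

(* Moving from a point [z] that is not a vertex both ways along a direction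
   orthogonal to the tight constraints writes [z] as a convex combination of two
   points with more tight constraints. *)
Lemma bounded_polyhedron_polytope :
  (forall z v, v != 0 -> exists s : R, 0 <= s /\ ~ polyhedron (z + s *: v)) ->
  convex_polytope polyhedron.
Proof.
move=> bnd; have /finite_seqP[l lE] := finite_vertices; exists l.
apply/seteqP; split=> [z Pz C [cC lC]|z].
  (* Induction on the number of slack constraints. *)
  have [m] := ubnP #|~: tight z|; elim: m => // m IH in z Pz *; rewrite ltnS => zm.
  have [zv|nzv] := pselect (vertex z); first by apply: lC; rewrite -lE.
  have [v vz v0] : exists2 v, (forall i, i \in tight z -> dot v (a i) = 0) & v != 0.
    apply: contrapT => h; apply: nzv; split=> // v vz; apply/eqP/negP => /negP v0.
    by apply: h; exists v.
  have [s1 [s10 P1 t1]] := tight_exit Pz vz (bnd z v v0).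
  have [||s2 [s20 P2 t2]] := @tight_exit z (- v) Pz.
  - by move=> i iz; rewrite dotNl vz // oppr0.
  - by apply: bnd; rewrite oppr_eq0.
  have C1 : C (z + s1 *: v).
    by apply: IH => //; apply: leq_trans zm; rewrite proper_card // properC.
  have C2 : C (z + s2 *: - v).
    by apply: IH => //; apply: leq_trans zm; rewrite proper_card // properC.
  have s01 : 0 <= s2 / (s1 + s2) <= 1 by rewrite divr_ge0 ?ler_pdivrMr; lra.
  have -> : z = z + s2 *: - v + (s2 / (s1 + s2)) *: (z + s1 *: v - (z + s2 *: - v)).
    by apply/rowP => i; rewrite !mxE; field; rewrite gt_eqF ?addr_gt0.
  exact: convex_segment.
apply; split=> [x y t|y].
  rewrite !inE => Px Py i; rewrite /conv /= dotDl !dotZl.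
  have t0 : 0 <= t%:num by exact: ge0.
  have t1 : 0 <= 1 - t%:num by rewrite subr_ge0 le1.
  have := lerD (ler_wpM2l t0 (Px i)) (ler_wpM2l t1 (Py i)).
  by rewrite -mulrDl subrKC mul1r.
by rewrite -lE => -[].
Qed.

End Polyhedron.

(** * Box volumes and null sets *)

Section NullSets.
Context {R : realType}.
Local Notation lebR := (@lebesgue_measure R).

Lemma measurable_scaled_indic (u a b : R) :
  measurable_fun setT (fun x : R => (u * \1_(`[a, b]%classic : set R) x)%:E).
Proof.
by apply/measurable_EFinP; apply: measurable_funM.
Qed.

Lemma integral_scaled_indic (u a b : R) : 0 <= u -> a <= b ->
  (\int[lebR]_x (u * \1_(`[a, b]%classic : set R) x)%:E = (u * (b - a))%:E)%E.
Proof.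
move=> u0 ab; under eq_integral do rewrite EFinM.
rewrite ge0_integralZl_EFin //; last first.
  by apply/measurable_EFinP; apply: measurable_indic; exact: measurable_itv.
rewrite integral_indic //= setIT lebesgue_measure_itv /= lte_fin EFinM.
by case: ltP => // ba; rewrite (@le_anti _ _ a b) ?ab ?subrr.
Qed.

(* Integrating out one coordinate at a time turns the pointwise domination of
   indicators into a domination of volumes; the weights [c] and [c_ k] carry the
   lengths of the sides already integrated out. *)
Lemma box_cover_volume (n : nat) (a b : nat -> R) (a_ b_ : nat -> nat -> R)
    (c : R) (c_ : nat -> R) :
  (forall i, a i <= b i) -> (forall k i, a_ k i <= b_ k i) ->
  0 <= c -> (forall k, 0 <= c_ k) ->
  (forall x : nat -> R,
    ((c * \prod_(i < n) \1_(`[a i, b i]%classic : set R) (x i))%:E <=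
     \sum_(0 <= k <oo)
       (c_ k * \prod_(i < n) \1_(`[a_ k i, b_ k i]%classic : set R) (x i))%:E)%E) ->
  ((c * \prod_(i < n) (b i - a i))%:E <=
     \sum_(0 <= k <oo) (c_ k * \prod_(i < n) (b_ k i - a_ k i))%:E)%E.
Proof.
move=> ab ab_; elim: n => [|n IH] in c c_ *; move=> c0 c_0 h.
  have := h (fun=> 0); rewrite !big_ord0.
  by congr (_ <= _)%E; apply: eq_eseriesr => k _; rewrite !big_ord0.
have prod_ge0 (m : nat) (a' b' x : nat -> R) :
    0 <= (\prod_(i < m) \1_(`[a' i, b' i]%classic : set R) (x i) : R).
  exact: prodr_ge0.
(* The length of the last side moves into the weights; the domination that remains comes from
   integrating over the last coordinate. *)
rewrite big_ord_recr /= mulrCA mulrC.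
under eq_eseriesr do rewrite big_ord_recr /= mulrCA mulrC.
apply: IH => [|k|x].
- by rewrite mulr_ge0 // subr_ge0.
- by rewrite mulr_ge0 // subr_ge0.
pose p (a' b' : nat -> R) : R := \prod_(i < n) \1_(`[a' i, b' i]%classic : set R) (x i).
have p_ge0 a' b' : 0 <= p a' b' by exact: prod_ge0.
have -> : (c * (b n - a n) * p a b)%:E =
    (\int[lebR]_t (c * p a b * \1_(`[a n, b n]%classic : set R) t)%:E)%E.
  by rewrite integral_scaled_indic ?mulr_ge0 // mulrAC.
have -> : (\sum_(0 <= k <oo) (c_ k * (b_ k n - a_ k n) * p (a_ k) (b_ k))%:E =
    \sum_(0 <= k <oo)
      \int[lebR]_t (c_ k * p (a_ k) (b_ k) * \1_(`[a_ k n, b_ k n]%classic : set R) t)%:E)%E.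
  by apply: eq_eseriesr => k _; rewrite integral_scaled_indic ?mulr_ge0 // mulrAC.
rewrite -integral_nneseries //; last 2 first.
- by move=> k; exact: measurable_scaled_indic.
- by move=> k t _; rewrite lee_fin !mulr_ge0.
apply: ge0_le_integral => //.
- by move=> t _; rewrite lee_fin !mulr_ge0.
- exact: measurable_scaled_indic.
- apply: ge0_emeasurable_sum => [k t _ _|k _]; last exact: measurable_scaled_indic.
  by rewrite lee_fin !mulr_ge0.
move=> t _; have := h (fun i => if i == n then t else x i).
have pE (a' b' : nat -> R) : \prod_(i < n.+1) \1_(`[a' i, b' i]%classic : set R) (if (i : nat) == n then t else x i) =
    p a' b' * \1_(`[a' n, b' n]%classic : set R) t.
  rewrite big_ord_recr /= eqxx; congr (_ * _).
  by apply: eq_bigr => i _; rewrite ltn_eqF.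
rewrite pE mulrA; congr (_ <= _)%E.
by apply: eq_eseriesr => k _; rewrite pE mulrA.
Qed.

(** Otherwise [N] contains cubes of side arbitrarily close to some [r], yet is covered by boxes of
    total volume below [r ^+ d]; [box_cover_volume] forbids this. *)
Lemma null_avoids_open (d : nat) (N O : set 'rV[R]_d) :
  lebesgue_null N -> open O -> O !=set0 -> exists2 x, O x & ~ N x.
Proof.
move=> N0 oO [p Op]; apply: contrapT => h.
have ON : O `<=` N by move=> x Ox; apply: contrapT => Nx; apply: h; exists x.
have /nbhs_ballP[r /= r0 rO] := open_nbhs_nbhs (conj oO Op).
have [|a [b [ab NU]]] := N0 (r ^+ d); first exact: exprn_gt0.
rewrite ltNge => /negP; apply.
(* Pads a vector to a sequence, the form that [box_cover_volume] takes for its induction on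
   dimension. *)
pose ext (u : 'rV[R]_d) (z : R) (i : nat) : R :=
  if insub i is Some j then u ord0 j else z.
have extE u z (j : 'I_d) : ext u z j = u ord0 j by rewrite /ext valK.
have := @box_cover_volume d (ext (p - const_mx (r / 2)) 0) (ext (p + const_mx (r / 2)) 0)
  (fun k => ext (a k) 0) (fun k => ext (b k) 0) 1 (fun=> 1).
have -> : 1 * \prod_(i < d) (ext (p + const_mx (r / 2)) 0 i - ext (p - const_mx (r / 2)) 0 i)
    = r ^+ d.
  rewrite mul1r -[in RHS](card_ord d) -prodr_const; apply: eq_bigr => i _.
  by rewrite !extE !mxE; field.
have -> : (\sum_(0 <= k <oo) (1 * \prod_(i < d) (ext (b k) 0 i - ext (a k) 0 i))%:E =
    \sum_(0 <= k <oo) (box_vol (a k) (b k))%:E)%E.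
  apply: eq_eseriesr => k _; rewrite mul1r; congr (_%:E).
  by apply: eq_bigr => i _; rewrite !extE.
apply=> //.
- by move=> i; rewrite /ext; case: insubP => // j _ _; rewrite !mxE; lra.
- by move=> k i; rewrite /ext; case: insubP.
move=> x; pose q := \row_(i < d) x i.
have [qp|qp] := pselect (forall i : 'I_d, p ord0 i - r / 2 <= x i <= p ord0 i + r / 2).
  have [|k _ qk] := NU q.
    apply/ON/rO; split=> // i j; rewrite (ord1 i) -ball_normE /= mxE.
    by rewrite ltr_norml; have := qp j; lra.
  have term_ge0 m : (0 <= (1 * \prod_(i < d)
      \1_(`[ext (a m) 0 i, ext (b m) 0 i]%classic : set R) (x i) : R)%:E)%E.
    by rewrite lee_fin mul1r; apply: prodr_ge0.
  apply: (@le_trans _ _ 1%:E).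
    by rewrite lee_fin mul1r; apply: prodr_ile1 => i _; rewrite indicE; case: (_ \in _); rewrite ?lexx ?ler01.
  rewrite (@nneseriesD1 _ _ k) // -[leLHS]adde0 leeD ?nneseries_ge0 // lee_fin mul1r.
  rewrite big1 // => i _; rewrite indicE mem_set //= in_itv /= !extE.
  by have := qk i; rewrite mxE.
apply: (@le_trans _ _ 0%:E); last first.
  by apply: nneseries_ge0 => m _ _; rewrite lee_fin mul1r; apply: prodr_ge0.
rewrite lee_fin mul1r; move/existsNP : qp => [i /negP qi].
rewrite (bigD1 i) //= indicE memNset ?mul0r // => xi; apply: (negP qi).
by move: xi; rewrite /= in_itv /= !extE !mxE.
Qed.

End NullSets.

(** * Open sets, rational balls and boundedness *)

Lemma open_measurableRd {R : realType} {d : nat} (A : set 'rV[R]_d) :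
  open A -> measurable (A : set (BorelRd R d)).
Proof. by move=> oA; exact: sub_sigma_algebra. Qed.

Lemma rat_ball_approx {R : realType} {d : nat} (a : 'rV[R]_d) (O : set 'rV[R]_d) :
  open O -> O a -> exists (q : 'rV[rat]_d) (k : nat),
    ball (map_mx ratr q : 'rV[R]_d) k.+1%:R^-1 `<=` O.
Proof.
move=> oO Oa; have /nbhs_ballP[e /= e0 eO] := open_nbhs_nbhs (conj oO Oa).
pose k := Num.truncn (2 / e); have k0 : 0 < k.+1%:R^-1 :> R by rewrite invr_gt0.
have ke : k.+1%:R^-1 < e / 2.
  rewrite -(invrK (e / 2)) ltf_pV2 ?posrE ?invr_gt0 ?divr_gt0 // invf_div.
  exact: truncnS_gt.
have hq (i : 'I_d) : {q : rat | `|a ord0 i - ratr q| < k.+1%:R^-1}.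
  apply: cid; have [|q] := @rat_in_itvoo R (a ord0 i - k.+1%:R^-1) (a ord0 i + k.+1%:R^-1).
    by rewrite ltrBlDr -addrA ltrDl addr_gt0.
  by rewrite in_itv /= => qi; exists q; rewrite ltr_distlC.
exists (\row_i sval (hq i)), k => w qw; apply: eO.
set c : 'rV[R]_d := map_mx _ _ in qw *; rewrite (splitr e).
have ac : ball a (e / 2) c; last exact: (ball_triangle ac (le_ball (ltW ke) qw)).
apply: (le_ball (ltW ke)); split=> // i j; rewrite (ord1 i) -ball_normE /= !mxE.
exact: (svalP (hq j)).
Qed.

Lemma continuous_translation {R : realType} {d : nat} (c : 'rV[R]_d) :
  continuous (fun w : 'rV[R]_d => w + c).
Proof.
by move=> w; apply: continuousD; [exact: cvg_id|exact: cst_continuous].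
Qed.

Lemma compact_bounded_norm {R : realType} {d : nat} (K : set 'rV[R]_d) :
  compact K -> exists2 M : R, 0 < M & forall w, K w -> `|w| < M.
Proof.
move=> /compact_bounded /ex_strict_bound_gt0[M M0 h].
by exists M.
Qed.

(** * Mass of translates under the tiling measure *)

Section WeakTiling.
Context {R : realType} {d : nat} (K N : set 'rV[R]_d)
  (mu : {measure set (BorelRd R d) -> \bar R}).
Hypotheses (bodyK : convex_body K) (lf : locally_finite mu) (N0 : lebesgue_null N).
Hypothesis tiling : forall x : 'rV[R]_d, ~ N x ->
  (\int[mu]_y (\1_K (x - y) : R)%:E)%E = (\1_(~` K) x : R)%:E.
Local Open Scope ereal_scope.

Let cK : @convex_set R 'rV[R]_d K. Proof. by case: bodyK. Qed.
Let K0 : interior K !=set0. Proof. by case: bodyK. Qed.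
Let compK : compact K. Proof. by case: bodyK. Qed.
Let clK : closed K. Proof. exact: compact_closed (@norm_hausdorff _ _) compK. Qed.

(** Its mass is the value at [x] of the convolution of [mu] with the indicator of [K]. *)
Definition covering (x : 'rV[R]_d) : set (BorelRd R d) := 
  [set t : 'rV[R]_d | K (x - t)%R].

Lemma measurable_covering x : measurable (covering x).
Proof.
rewrite -[covering x]setCK; apply: measurableC; apply: open_measurableRd.
apply: closed_openC; apply: (@closed_comp _ _ (fun t : 'rV[R]_d => x - t)%R) => //.
move=> t _; apply: continuousB; first exact: cst_continuous.
exact: cvg_id.
Qed.

Lemma mu_covering x : ~ N x -> mu (covering x) = (\1_(~` K) x : R)%:E.
Proof.
move=> Nx; rewrite -tiling // -[in LHS](setIT (covering x)).
rewrite -integral_indic //; exact: measurable_covering.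
Qed.

Lemma open_overlap : open (overlap K).
Proof.
have -> : overlap K = \bigcup_(b in interior K) (fun t => t + b)%R @^-1` interior K.
  apply/seteqP; split=> [_ [a [b [Ka Kb ->]]]|t [b Kb Ka]].
    by exists b => //=; rewrite subrK.
  by exists (t + b)%R, b; split=> //; rewrite addrK.
apply: bigcup_open => b _; apply: open_comp; last exact: open_interior.
by move=> t _; exact: continuous_translation.
Qed.

(** [covering z] is null for interior [z] off [N]. If [t] overlaps, the interiors of [K] and [K + t]
    share a rational ball, and [t] is in [covering z] for the point [z] chosen in it; so countably
    many null sets suffice. *)
Lemma mu_overlap : mu (overlap K) = 0.
Proof.
have good (i : 'rV[rat]_d * nat) : {z : 'rV[R]_d |
    ball (map_mx ratr i.1 : 'rV[R]_d) i.2.+1%:R^-1 z & ~ N z}.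
  apply: cid2; apply: null_avoids_open => //; first exact: ball_open.
  by exists (map_mx ratr i.1); apply: ballxx.
pose F n := if unpickle n is Some i then
  if `[< interior K (s2val (good i)) >] then covering (s2val (good i)) else set0 else set0.
have sub : (overlap K : set (BorelRd R d)) `<=` \bigcup_n F n.
  move=> _ [a [b [Ka Kb ->]]].
  pose O := interior K `&` ((fun w : 'rV[R]_d => w + (b - a))%R @^-1` interior K).
  have [||q [k qO]] := @rat_ball_approx R d a O.
  - apply: openI; first exact: open_interior.
    apply: open_comp; last exact: open_interior.
    by move=> w _; exact: continuous_translation.
  - by split=> //=; rewrite subrKC.
  exists (pickle (q, k)) => //; rewrite /F pickleK.
  have [zK zt] := qO _ (s2valP (good (q, k))).
  by rewrite asboolT // /covering /= opprB; exact: interior_subset.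
have : mu.-negligible (\bigcup_n F n).
  apply: negligible_bigcup => n; rewrite /F; case: unpickle => [i|]; last exact: negligible_set0.
  case: asboolP => [iK|_]; last exact: negligible_set0.
  apply/negligibleP; first exact: measurable_covering.
  apply: etrans (mu_covering (s2valP' (good i))) _.
  by rewrite indicE memNset // => nK; exact: nK (interior_subset iK).
move=> /(negligibleS sub) U0.
by apply/negligibleP => //; apply: open_measurableRd; exact: open_overlap.
Qed.

Lemma mu_bounded (A : set (BorelRd R d)) (M : R) : measurable A ->
  (forall t : 'rV[R]_d, A t -> (`|t| < M)%R) -> mu A < +oo.
Proof.
move=> mA AM; apply: le_lt_trans (lf 0%R M); apply: le_measure.
- by rewrite inE.
- by rewrite inE; apply: open_measurableRd; exact: ball_open.
by move=> t /AM; rewrite -ball_normE /= sub0r normrN.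
Qed.

(** Continuity from above: [covering x] is the intersection of its decreasing neighbourhoods [E k],
    and each contains some [covering x'] of mass 1 with [x'] near [x] outside [K]. *)
Lemma mu_covering_boundary x : K x -> ~ interior K x -> 1 <= mu (covering x).
Proof.
move=> Kx nKx.
pose E k : set (BorelRd R d) := \bigcup_(z in K) ball (x - z)%R (k.+1%:R^-1 : R).
have mE k : measurable (E k).
  by apply: open_measurableRd; apply: bigcup_open => z _; exact: ball_open.
have capE : \bigcap_k E k = covering x.
  apply/seteqP; split=> [t Et|t Kxt k _]; last first.
    by exists (x - t)%R => //; rewrite subKr; exact: ballxx.
  apply: clK => B /nbhs_ballP[e /= e0 eB].
  have [z Kz zt] := Et (Num.truncn (e^-1)) I.
  have ke : ((Num.truncn e^-1).+1%:R^-1 <= e)%R.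
    by rewrite invf_ple ?posrE // ltW // truncnS_gt.
  exists z; split=> //; apply: eB; apply: (le_ball ke).
  move: zt; rewrite -!ball_normE /=; congr (_ < _)%R.
  by rewrite addrAC.
have decE : {homo E : n m / (n <= m)%N >-> (m <= n)%O}.
  move=> n m nm; apply/subsetPset => t [z Kz zt]; exists z => //.
  by apply: le_ball zt; rewrite lef_pV2 ?posrE ?ler_nat.
have finE : mu (E 0%N) < +oo.
  have [M M0 KM] := compact_bounded_norm compK.
  apply: (@mu_bounded _ (M + M + 1)%R) => // t [z Kz].
  rewrite -ball_normE /= invr1 => zt.
  have -> : t = (x - z - (x - z - t))%R by rewrite subKr.
  apply: le_lt_trans (ler_normB _ _) _; apply: ltrD => //.
  by apply: le_lt_trans (ler_normB _ _) _; apply: ltrD; exact: KM.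
have cvgE := nonincreasing_cvg_mu finE mE.
rewrite capE in cvgE; have {}cvgE := cvgE (measurable_covering x) decE.
rewrite -(cvg_lim _ cvgE) //; apply: lime_ge; first by apply/cvg_ex; eexists; exact: cvgE.
apply: nearW => k /=.
have k0 : (0 < k.+1%:R^-1 :> R)%R by rewrite invr_gt0.
have [||x' [xx' nKx'] Nx'] := @null_avoids_open R d N (ball x (k.+1%:R^-1 : R) `&` ~` K) N0.
- apply: openI; first exact: ball_open.
  exact: closed_openC.
- apply: contrapT => h; apply: nKx; apply/nbhs_ballP; exists (k.+1%:R^-1)%R => // w xw.
  by apply: contrapT => nKw; apply: h; exists w.
have -> : 1 = mu (covering x') by rewrite mu_covering // indicE mem_set.
apply: le_measure; rewrite ?inE //; first exact: measurable_covering.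
move=> t Kt; exists (x' - t)%R => //.
move: xx'; rewrite -!ball_normE /=; congr (_ < _)%R; congr (`| _ |)%R.
by apply/rowP => i; rewrite !mxE; ring.
Qed.

Definition touching_covering x := covering x `\` overlap K.

Lemma measurable_touching_covering x : measurable (touching_covering x).
Proof.
apply: measurableD; first exact: measurable_covering.
by apply: open_measurableRd; exact: open_overlap.
Qed.

Lemma mu_touching_covering x n : touching K x n -> 1 <= mu (touching_covering x).
Proof.
move=> xn; have mU : measurable (overlap K : set (BorelRd R d)).
  by apply: open_measurableRd; exact: open_overlap.
have := mu_covering_boundary (touching_mem clK xn); have [_ nKx _] := xn.
move=> /(_ nKx) /le_trans; apply.
rewrite (measureDI mu (measurable_covering x) mU) [X in _ + X](_ : _ = 0) ?adde0 //.
apply: (subset_measure0 _ mU _ mu_overlap); last exact: subIsetr.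
by apply: measurableI => //; exact: measurable_covering.
Qed.

(* Distinct supporting halfspaces at touching points have disjoint sets of
   touching translates, each of mass at least 1. *)
Lemma many_touching_points : ~ convex_polytope K -> forall m : nat,
  exists L : seq ('rV[R]_d * 'rV[R]_d),
    (forall p, p \in L -> touching K p.1 p.2) /\
    m%:R%:E <= mu (\bigcup_(p in [set` L]) touching_covering p.1).
Proof.
move=> nP; elim=> [|m [L [Lt Lmu]]].
  by exists [::]; split=> //; rewrite measure_ge0.
(* The halfspaces found so far cut out a polyhedron containing [K]. It differs from [K], so some [y]
   in it lies outside [K] and violates the halfspace at a new touching point [x]. *)
pose P := polyhedron (fun i : 'I_(size L) => (tnth (in_tuple L) i).2)
  (fun i => dot (tnth (in_tuple L) i).1 (tnth (in_tuple L) i).2).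
have KP : K `<=` P.
  move=> z Kz i; rewrite -subr_le0 -dotNl -dotDl.
  by apply: (touching_support cK (Lt _ (mem_tnth _ (in_tuple L)))).
have [y Py nKy] : exists2 y, P y & ~ K y.
  apply: contrapT => h; apply: nP.
  have PK : P = K.
    apply/seteqP; split=> // y Py; apply: contrapT => nKy; apply: h; by exists y.
  rewrite -PK; apply: bounded_polyhedron_polytope; rewrite -/P PK => z v v0.
  have [M M0 KM] := compact_bounded_norm compK.
  have v_gt0 : (0 < `|v|)%R by rewrite normr_gt0.
  exists ((M + `|z|) / `|v|)%R; split; first by rewrite divr_ge0 // addr_ge0 // ltW.
  move=> /KM; apply/negP; rewrite -leNgt.
  have := ler_normB (z + ((M + `|z|) / `|v|) *: v)%R z.
  rewrite addrAC subrr add0r normrZ ger0_norm ?divfK ?gt_eqF //; first lra.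
  by rewrite divr_ge0 // addr_ge0 // ltW.
have [x [n [xn yx]]] : exists x n, touching K x n /\ (0 < dot (y - x) n)%R.
  apply: contrapT => h; apply: nKy; apply: (mem_of_touching_halfspaces cK clK K0).
  move=> x n xn; rewrite leNgt; apply/negP => yx; apply: h; by exists x, n.
exists ((x, n) :: L); split.
  by move=> p; rewrite inE => /predU1P[->|/Lt].
have -> : [set` (x, n) :: L] = (x, n) |` [set` L].
  by apply/seteqP; split=> p /=; rewrite inE => /predU1P.
rewrite bigcup_setU1 measureU.
- rewrite -addn1 natrD EFinD addeC; apply: leeD => //.
  exact: mu_touching_covering xn.
- exact: measurable_touching_covering.
- apply: fin_bigcup_measurable => // p _; exact: measurable_touching_covering.
(* A translation shared with an earlier [p] would put the halfspace of [p] inside that of [x], but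
   [y] lies in the former only. *)
rewrite -subset0 => t [[Kt nUt] [p Lp [Kpt _]]] /=.
move: yx; apply/negP; rewrite -leNgt.
apply: (touching_halfspace_sub cK clK xn (Lt _ Lp) K0 nUt Kt Kpt).
have [i ip] : exists i : 'I_(size L), tnth (in_tuple L) i = p.
  by have /seq_tnthP[i ->] := Lp; exists i.
have := Py i; rewrite ip -subr_le0; congr (_ <= _)%R.
by rewrite !dotE.
Qed.

(** A [t] in [covering x] with [x] in [K] is a difference of two points of [K], so all the masses
    accumulate in one ball, whose mass is finite. *)
Lemma weak_tiling_polytope : convex_polytope K.
Proof.
apply: contrapT => /many_touching_points many.
have [M M0 KM] := compact_bounded_norm compK.
have bound : mu (ball (0%R : 'rV[R]_d) (M + M)) < +oo := lf _ _.
have [L [Lt Lmu]] := many (Num.truncn (fine (mu (ball (0%R : 'rV[R]_d) (M + M))))).+1.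
have : mu (\bigcup_(p in [set` L]) touching_covering p.1) <=
    mu (ball (0%R : 'rV[R]_d) (M + M)).
  apply: le_measure.
  - rewrite inE; apply: fin_bigcup_measurable => // p _.
    exact: measurable_touching_covering.
  - by rewrite inE; apply: open_measurableRd; exact: ball_open.
  move=> t [p Lp [Kt _]]; rewrite -ball_normE /= sub0r normrN.
  rewrite -(subKr p.1 t); apply: le_lt_trans (ler_normB _ _) _.
  have Kp := touching_mem clK (Lt _ Lp).
  apply: ltrD; apply: KM; [exact: Kp|exact: Kt].
move=> /(le_trans Lmu); apply/negP; rewrite -ltNge.
by rewrite -[ltLHS]fineK ?ge0_fin_numE // lte_fin truncnS_gt.
Qed.

End WeakTiling.

Unset Implicit Arguments. Set Strict Implicit.

Theorem theorem4p1 (R : realType) (d : nat) (K : set 'rV[R]_d)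
    (mu : {measure set (BorelRd R d) -> \bar R}) :
  convex_body K ->
  locally_finite mu ->
  (* 1_K * mu = 1_{K^c} Lebesgue-almost everywhere *)
  (exists N : set 'rV[R]_d, lebesgue_null N /\
     forall x : 'rV[R]_d, ~ N x ->
       (\int[mu]_y (\1_K (x - y) : R)%:E)%E = (\1_(~` K) x : R)%:E) ->
  convex_polytope K.
Proof.
by move=> bodyK lf [N [N0 tiling]]; exact: (weak_tiling_polytope bodyK lf N0 tiling).
Qed.
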